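(* The algorithm POC computes the power of chordality $k_0(G)$ of its input graph $G$ in time $O(n^4)$, where $n=|V(G)|$.
   Context: All graphs are finite and simple. For $k\in\mathbb N$, $G^k$ is the graph on $V(G)$ in which two distinct vertices are adjacent iff their distance in $G$ is at most $k$. A graph is chordal if it has no induced cycle of length at least $4$. The power of chordality $k_0(G)$ of $G$ is the smallest positive integer $k$ for which $G^k$ is chordal. Running time is worst-case number of elementary steps. Algorithm POC: on input a graph $G$ with $n$ vertices, for $k=1,2,\dots,n-1$ successively: compute $G^k$ and test whether $G^k$ is chordal; if it is, return $k$ and $G^k$ and stop. *)

(* Defs.v *)
From mathcomp Require Import all_boot.

Set Implicit Arguments.
Unset Strict Implicit.
Unset Printing Implicit Defensive.

(** * Powers of graphs and chordality *)

Record sgraph (V : finType) := SGraph {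
  adj :> rel V;
  adj_sym : symmetric adj;
  adj_irr : irreflexive adj
}.

Section Graphs.
Variables (V : finType) (G : sgraph V).

Definition has_walk (d : nat) (x y : V) : bool :=
  [exists p : d.-tuple V, path G x p && (last x p == y)].

Lemma connect_has_walk x y : connect G x y -> exists d, has_walk d x y.
Proof.
case/connectP=> p Gp ->; exists (size p); apply/existsP.
by exists (in_tuple p); rewrite Gp eqxx.
Qed.

(** [None] is the infinite distance between different components. *)
Definition dist (x y : V) : option nat :=
  if @idP (connect G x y) is ReflectT c
  then Some (ex_minn (connect_has_walk c)) else None.

Definition dist_le (k : nat) (x y : V) : bool :=
  if dist x y is Some d then d <= k else false.

Lemma dist_leP k x y :
  reflect (exists2 d, d <= k & has_walk d x y) (dist_le k x y).
Proof.
rewrite /dist_le /dist; case: {-}_ / idP => [c | nc].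
  case: ex_minnP => m wm min_m; apply: (iffP idP) => [le_mk | [d le_dk wd]].
    by exists m.
  exact: leq_trans (min_m d wd) le_dk.
constructor=> -[d _ /existsP[p /andP[Gp /eqP Dy]]]; case: nc.
by apply/connectP; exists p.
Qed.

Lemma has_walk_sym d : symmetric (has_walk d).
Proof.
suff W x y : has_walk d x y -> has_walk d y x.
  by move=> x y; apply/idP/idP; apply: W.
case/existsP=> p /andP[Gp /eqP <-]; apply/existsP.
have sz : size (rev (belast x p)) == d by rewrite size_rev size_belast size_tuple.
exists (Tuple sz) => /=; rewrite rev_path.
rewrite (eq_path (e' := G)); last by move=> u v; rewrite adj_sym.
rewrite Gp /=.
by case: (tval p) => //= u q; rewrite rev_cons last_rcons.
Qed.

Lemma dist_le_sym k : symmetric (dist_le k).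
Proof.
move=> x y; apply/dist_leP/dist_leP => -[d le_dk w];
  by exists d; rewrite // has_walk_sym.
Qed.

Lemma power_sym k : symmetric [rel x y | (x != y) && dist_le k x y].
Proof. by move=> x y; rewrite /= eq_sym dist_le_sym. Qed.

Lemma power_irr k : irreflexive [rel x y | (x != y) && dist_le k x y].
Proof. by move=> x; rewrite /= eqxx. Qed.

Definition power (k : nat) : sgraph V := SGraph (power_sym k) (power_irr k).

(** [ucycle G c]: the entries of [c] are pairwise distinct and cyclically
    consecutive ones are adjacent. *)
Definition induced_cycle (c : seq V) : Prop :=
  ucycle G c /\
  {in c &, forall x y, G x y -> (y == next c x) || (x == next c y)}.

Definition chordal : Prop := forall c : seq V, induced_cycle c -> size c < 4.

End Graphs.

Definition is_power_of_chordality (V : finType) (G : sgraph V) (k : nat) : Prop :=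
  [/\ 0 < k, chordal (power G k)
    & forall j, 0 < j -> chordal (power G j) -> k <= j].

(** * A machine model with step counting

    A random access machine with integer registers and two-dimensional
    integer arrays, programmed in a small deterministic imperative language.
    The only arithmetic operations are successor and predecessor, so after [t]
    steps no stored number exceeds by more than [t] the largest one initially
    present in the memory or the program: unit cost for every operation is
    realistic. *)

Inductive expr :=
| Cst (m : nat)
| Reg (x : nat)
| Get (a : nat) (i j : expr)
| Succ (e : expr)
| Pred (e : expr).

Inductive bexpr :=
| BEq (e f : expr)
| BLt (e f : expr)
| BNot (b : bexpr)
| BAnd (b c : bexpr).

Inductive cmd :=
| Skip
| Assign (x : nat) (e : expr)
| Put (a : nat) (i j e : expr)
| Seq (c d : cmd)
| If (b : bexpr) (c d : cmd)
| While (b : bexpr) (c : cmd).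

Record state := State {
  reg : nat -> nat;
  arr : nat -> nat -> nat -> nat
}.

Definition set_reg (s : state) (x v : nat) : state :=
  State (fun y => if y == x then v else reg s y) (arr s).

Definition set_arr (s : state) (a i j v : nat) : state :=
  State (reg s)
    (fun a' => if a' == a
               then fun i' j' => if (i' == i) && (j' == j) then v else arr s a i' j'
               else arr s a').

Fixpoint eval (s : state) (e : expr) : nat :=
  match e with
  | Cst m => m
  | Reg x => reg s x
  | Get a i j => arr s a (eval s i) (eval s j)
  | Succ e => (eval s e).+1
  | Pred e => (eval s e).-1
  end.

Fixpoint beval (s : state) (b : bexpr) : bool :=
  match b with
  | BEq e f => eval s e == eval s f
  | BLt e f => eval s e < eval s f
  | BNot b => ~~ beval s b
  | BAnd b c => beval s b && beval s c
  end.

(** Every operation in an expression is one elementary step. *)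
Fixpoint cost (e : expr) : nat :=
  match e with
  | Cst _ | Reg _ => 1
  | Get _ i j => (cost i + cost j).+1
  | Succ e | Pred e => (cost e).+1
  end.

Fixpoint bcost (b : bexpr) : nat :=
  match b with
  | BEq e f | BLt e f => (cost e + cost f).+1
  | BNot b => (bcost b).+1
  | BAnd b c => (bcost b + bcost c).+1
  end.

(** [exec c s t s']: started in state [s], the program [c] halts after exactly
    [t] elementary steps, in state [s']. *)
Inductive exec : cmd -> state -> nat -> state -> Prop :=
| ExecSkip s :
    exec Skip s 1 s
| ExecAssign x e s :
    exec (Assign x e) s (cost e).+1 (set_reg s x (eval s e))
| ExecPut a i j e s :
    exec (Put a i j e) s (cost i + cost j + cost e).+1
      (set_arr s a (eval s i) (eval s j) (eval s e))
| ExecSeq c d s t s' u s'' :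
    exec c s t s' -> exec d s' u s'' -> exec (Seq c d) s (t + u) s''
| ExecIfTrue b c d s t s' :
    beval s b -> exec c s t s' -> exec (If b c d) s (bcost b + t).+1 s'
| ExecIfFalse b c d s t s' :
    ~~ beval s b -> exec d s t s' -> exec (If b c d) s (bcost b + t).+1 s'
| ExecWhileFalse b c s :
    ~~ beval s b -> exec (While b c) s (bcost b).+1 s
| ExecWhileTrue b c s t s' u s'' :
    beval s b -> exec c s t s' -> exec (While b c) s' u s'' ->
    exec (While b c) s (bcost b + t + u).+1 s''.

(** * The algorithm POC *)

(** Registers: number of vertices, current exponent, and answer of the
    chordality test (0 for no).  Arrays: the input graph and its current
    power. *)
Definition rN := 0.
Definition rK := 1.
Definition rAns := 2.
Definition aG := 0.
Definition aP := 1.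

(** Adjacency matrices; the vertices are numbered by [enum_val]. *)
Definition encodes (M : nat -> nat -> nat) (V : finType) (G : sgraph V) : Prop :=
  forall i j : 'I_#|V|, M i j = G (enum_val i) (enum_val j).

(** Registers and array entries other than those mentioned are arbitrary. *)
Definition is_input (V : finType) (G : sgraph V) (s : state) : Prop :=
  reg s rN = #|V| /\ encodes (arr s aG) G.

(** [c] computes G^k, where k is the content of [rK]. *)
Definition computes_power (c : cmd) : Prop :=
  forall (V : finType) (G : sgraph V) (s : state),
    is_input G s -> 0 < reg s rK ->
    exists t s',
      [/\ exec c s t s', encodes (arr s' aP) (power G (reg s rK))
        & [/\ reg s' rN = reg s rN, reg s' rK = reg s rK & arr s' aG = arr s aG]].

(** [c] decides whether the graph stored in [aP] is chordal. *)
Definition tests_chordality (c : cmd) : Prop :=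
  forall (V : finType) (H : sgraph V) (s : state),
    reg s rN = #|V| -> encodes (arr s aP) H ->
    exists t s',
      [/\ exec c s t s', reg s' rAns <> 0 <-> chordal H
        & [/\ reg s' rN = reg s rN, reg s' rK = reg s rK,
              arr s' aG = arr s aG & arr s' aP = arr s aP]].

(** For k = 1, ..., n - 1: compute G^k and test whether it is chordal; if so,
    return k (in [rK]) and G^k (in [aP]).  A nonzero final [rAns] means that the
    loop was left through this return.  If n <= 1 then the range of k is empty and
    [rK] keeps its initial value 1. *)
Definition POC (compute_power test_chordality : cmd) : cmd :=
  Seq (Assign rK (Cst 1))
 (Seq (Assign rAns (Cst 0))
      (While (BAnd (BEq (Reg rAns) (Cst 0)) (BLt (Reg rK) (Reg rN)))
        (Seq compute_power
        (Seq test_chordality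
             (If (BEq (Reg rAns) (Cst 0))
                 (Assign rK (Succ (Reg rK)))
                 Skip))))).

(* Main.v *)
Require Import Defs.
From mathcomp Require Import all_boot zify.

(** POC makes at most [n - 1] rounds, since [G^(n-1)] joins any two vertices of
    the same component and is therefore chordal; it stops at the first
    chordal power, which is the definition of the power of chordality.  What has
    to be found is a pair of subroutines that run in time [O(n^3)].

    Both are written in a language of bounded loops ([prog]), in which a program
    has a total denotation ([den]) and, once compiled, a running time
    [O(n^d)], where [d] is its loop nesting depth ([run_ok]).  The time
    analysis thus reduces to the remark that neither program nests more than
    three loops, and their correctness is proved on the denotations with loop
    invariants ([for_inv], [for2_each]).

    The power [G^k] is obtained by thresholding at [k] the distance matrix that
    the Floyd-Warshall recurrence computes ([relax_allP], [power_of_distances]).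
    The machine cannot add in one step, so the required sums are read from a
    table built by repeated successors ([tabulate_sums]).

    Chordality is tested by a maximum cardinality search, which visits at each
    round an unvisited vertex with the largest number of visited neighbours,
    followed by the verification that the earlier neighbours of every
    vertex form a clique.  If they do, a long induced cycle would have a chord
    at its last vertex ([perfect_chordal]).  Conversely, if two earlier
    neighbours of a vertex are not adjacent, they are the ends of an induced path
    whose interior is visited after both ends; the search rule turns such a
    path into one of the same kind with earlier ends, a descent that only a long
    induced cycle can stop ([no_valley]). *)

Set Implicit Arguments.
Unset Strict Implicit.
Unset Printing Implicit Defensive.

(** * Chordal graphs and elimination orders *)

Section EliminationOrders.
Variables (V : finType) (H : sgraph V).

(** Paths are indexed by natural numbers rather than given as sequences, so
    that cutting, extending and reversing them are arithmetic on indices; this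
    is the way back to sequences. *)
Lemma mkseq_induced_cycle (g : nat -> V) l : 2 < l ->
    (forall i j, i < j -> j <= l -> g i != g j) ->
    (forall i j, i < j -> j <= l ->
       H (g i) (g j) = (j == i.+1) || ((i == 0) && (j == l))) ->
  induced_cycle H (mkseq g l.+1).
Proof.
move=> l_gt2 gN gH.
have g_inj i j : i <= l -> j <= l -> g i = g j -> i = j.
  move=> lei lej eqg; case: (ltngtP i j) => // lt_ij.
    by have:= gN _ _ lt_ij lej; rewrite eqg eqxx.
  by have:= gN _ _ lt_ij lei; rewrite eqg eqxx.
have Ug : uniq (mkseq g l.+1).
  rewrite map_inj_in_uniq ?iota_uniq // => i j.
  by rewrite !mem_iota !add0n !ltnS /=; apply: g_inj.
have nextE i : i <= l -> next (mkseq g l.+1) (g i) = if i == l then g 0 else g i.+1.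
  move=> le_il.
  have gi : nth (g 0) (mkseq g l.+1) i = g i by rewrite nth_mkseq.
  have idx : index (g i) (mkseq g l.+1) = i.
    by rewrite -[in LHS]gi index_uniq ?size_mkseq.
  rewrite next_nth -index_mem idx size_mkseq ltnS le_il.
  rewrite /mkseq /= (iotaDl 1 0) -map_comp.
  case: eqP => [->|/eqP ne_il]; first by rewrite nth_default ?size_map ?size_iota.
  rewrite (nth_map 0) ?size_iota ?nth_iota /=; try lia.
  by rewrite add0n.
split; first (rewrite /ucycle Ug andbT).
  rewrite /mkseq /=; apply/(pathP (g 0)) => i.
  rewrite size_rcons size_map size_iota => lt_il.
  rewrite -rcons_cons -map_cons (_ : 0 :: _ = iota 0 l.+1) // !nth_rcons.
  rewrite !size_map !size_iota lt_il (nth_map 0) ?size_iota // nth_iota // add0n.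
  case: ltnP => le_li.
    by rewrite (nth_map 0) ?size_iota // nth_iota // gH ?add1n ?eqxx //; lia.
  have ->: i = l by lia.
  by rewrite eqxx adj_sym gH ?eqxx ?orbT //; lia.
move=> x y /mapP[i]; rewrite mem_iota add0n ltnS => /andP[_ le_il] ->.
move=> /mapP[j]; rewrite mem_iota add0n ltnS => /andP[_ le_jl] -> gij.
wlog lt_ij : i j le_il le_jl gij / i < j.
  move=> W; case: (ltngtP i j) => [/W->//|lt_ji|eq_ij].
    by rewrite orbC W // adj_sym.
  by rewrite eq_ij adj_irr in gij.
move: gij; rewrite gH // => /orP[/eqP Dj | /andP[/eqP -> /eqP->]].
  rewrite nextE // ifN ?Dj ?eqxx //; lia.
by rewrite (nextE l) // !eqxx orbT.
Qed.

(** Long cycles are excluded below by contradicting this local consequence, which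
    makes successors along the cycle unnecessary elsewhere. *)
Lemma induced_cycle_neighbours c a : induced_cycle H c -> 3 < size c -> a \in c ->
  exists x y, [/\ x \in c /\ y \in c, H a x, H a y, x != y & ~~ H x y].
Proof.
move=> [uc ic] c_ge4 ac.
have Hc := ucycle_cycle uc; have Uc := ucycle_uniq uc.
have yc : prev c a \in c by rewrite mem_prev.
have [i c' Dc] := rot_to yc.
have nextc z : next c z = next (prev c a :: c') z by rewrite -Dc next_rot.
have Da : next c (prev c a) = a by rewrite next_prev.
have: ucycle H (prev c a :: c') by rewrite -Dc rot_ucycle.
have: 3 < size (prev c a :: c') by rewrite -Dc size_rot.
have memc z : z \in prev c a :: c' -> z \in c by rewrite -Dc mem_rot.
move: (prev c a) Da yc Dc nextc memc => y Da yc Dc nextc memc.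
case: c' => [|a' [|x [|z q]]] // in Dc nextc memc *.
move: Da; rewrite nextc /= eqxx => Da; rewrite {}Da in Dc nextc memc * => _.
rewrite /ucycle /= !inE !negb_or -!andbA.
case/and5P=> Hya Hax _ _ /and5P[nya nyx nyz _ /and3P[nax naz _]].
have xc: x \in c by rewrite memc // !inE eqxx !orbT.
exists x, y; split=> //; [by rewrite adj_sym | by rewrite eq_sym |].
apply/negP => /(ic _ _ xc yc); rewrite !nextc /= eqxx.
rewrite [x == y]eq_sym (negPf nyx) [x == a]eq_sym (negPf nax) eqxx (negPf nyz) /=.
by rewrite eq_sym (negPf nax).
Qed.

Definition perfect (O : V -> nat) : Prop :=
  forall a b c, H a b -> H a c -> O b < O a -> O c < O a -> b != c -> H b c.

(** The vertex of a long cycle that comes last in the order has two earlier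
    neighbours on the cycle, and their adjacency is a chord. *)
Lemma perfect_chordal (O : V -> nat) : injective O -> perfect O -> chordal H.
Proof.
move=> injO PO c ic; rewrite ltnNge; apply/negP => c_ge4.
have [a0 a0c] : exists a0, a0 \in c.
  by case: c c_ge4 {ic} => // a0 c _; exists a0; rewrite mem_head.
have [a ac maxa] := @arg_maxnP _ a0 (mem c) O a0c.
have [x [y [[xc yc] Hax Hay nxy /negP[]]]] := induced_cycle_neighbours ic c_ge4 ac.
have ltO z : z \in c -> H a z -> O z < O a.
  move=> zc Haz; rewrite ltn_neqAle [O z <= _]maxa // andbT; apply/eqP => /injO Dz.
  by rewrite Dz adj_irr in Haz.
by apply: (PO a); rewrite ?ltO.
Qed.

(** The defining property of maximum cardinality search, once it is complete:
    [v] was preferred to every later [w]. *)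
Definition mcs_order (O : V -> nat) : Prop := forall v w, O v < O w ->
  #|[set x | (O x < O v) && H x w]| <= #|[set x | (O x < O v) && H x v]|.

(** [u] is counted for [w] and not for [v], so some [x] must be counted for [v]
    and not for [w]. *)
Lemma mcs_private (O : V -> nat) u v w : mcs_order O ->
    O u < O v -> O v < O w -> H u w -> ~~ H u v ->
  exists x, [/\ O x < O v, H x v & ~~ H x w].
Proof.
move=> mO uv vw Huw nHuv; set A := [set x | (O x < O v) && H x w].
set B := [set x | (O x < O v) && H x v].
have : ~~ (B \subset A).
  apply/negP => sBA; have: B \proper A.
    rewrite properE sBA; apply/subsetPn; exists u.
      by rewrite inE uv Huw.
    by rewrite inE uv (negPf nHuv).
  by move=> /proper_card; rewrite ltnNge mO.
case/subsetPn=> x; rewrite !inE => /andP[xv Hxv]; rewrite xv /= => nHxw.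
by exists x.
Qed.

Definition induced_path (f : nat -> V) k : Prop := forall i j, i < j -> j <= k ->
  f i != f j /\ H (f i) (f j) = (j == i.+1).

Lemma induced_path_rev f k : induced_path f k -> induced_path (fun i => f (k - i)) k.
Proof.
move=> If i j lt_ij le_jk; have [||ne adj] := If (k - j) (k - i); try lia.
rewrite eq_sym adj_sym; split=> //; rewrite adj; apply/eqP/eqP; lia.
Qed.

(** If the ends [u] and [v] of an induced path precede all its interior
    vertices and [u] precedes [v], then the search gives a neighbour [x] of [v]
    preceding [v] that is not adjacent to the successor of [u].  Cut the path
    at the first vertex after [u] that is adjacent to [x] and append [x]: the
    result either closes to a long induced cycle or is an induced path of the same
    kind, whose ends both precede [v]. *)
Lemma no_valley O : chordal H -> injective O -> mcs_order O ->
  forall N f k, 1 < k -> induced_path f k ->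
    (forall i, 0 < i -> i < k -> O (f 0) < O (f i) /\ O (f k) < O (f i)) ->
    O (f 0) < N -> O (f k) < N -> False.
Proof.
move=> cH injO mO; elim=> // N IH f k k_gt1 If lowf f0N fkN.
wlog lt_uv : f If lowf f0N fkN / O (f 0) < O (f k).
  move=> W; case: (ltngtP (O (f 0)) (O (f k))) => [lt0k|ltk0|/injO eq0k].
  - exact: (W f).
  - apply: (W (fun i => f (k - i))); rewrite ?subn0 ?subnn //.
      exact: induced_path_rev.
    by move=> i i0 ik; rewrite and_comm; apply: lowf; lia.
  - by have [|//|] := If 0 k; rewrite ?eq0k ?eqxx //; lia.
have [_ Huw] : f 0 != f 1 /\ H (f 0) (f 1) by have [//||? ->] := If 0 1; first lia.
have nHuv : ~~ H (f 0) (f k) by have [||? ->] := If 0 k; lia.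
have [|_ lt_vw] := lowf 1 isT; first lia.
have [x [lt_xv Hxv nHxw]] := mcs_private mO lt_uv lt_vw Huw nHuv.
have nxf i : 0 < i -> i <= k -> f i != x.
  move=> i0 ik; apply/eqP => Dx; move: lt_xv; rewrite -Dx.
  case: (ltngtP i k) ik => // [ik|->]; last by rewrite ltnn.
  by move=> _; have [_] := lowf i i0 ik; lia.
have nxu : f 0 != x by apply: contraNneq nHuv => ->.
(* The least such [j] keeps [x] away from the interior of the shortened path. *)
have exj : exists j, (0 < j <= k) && H x (f j) by exists k; rewrite Hxv; lia.
case: (ex_minnP exj) => j /andP[/andP[j0 jk] Hxj] minj.
have j_gt1 : 1 < j.
  by case: j j0 Hxj {jk minj} => [|[|j]] // _; rewrite (negPf nHxw).
have nHxi i : 0 < i -> i < j -> H x (f i) = false.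
  by move=> i0 ij; apply/negP => Hxi; have := minj i; rewrite Hxi; lia.
pose g i := if i <= j then f i else x.
have gN i l : i < l -> l <= j.+1 -> g i != g l.
  move=> lt_il le_lj; rewrite /g; have ->: i <= j by lia.
  case: leqP => [lj|_]; first by have [||] := If i l; lia.
  by case: (posnP i) => [->//|i0]; apply: nxf; lia.
have gH i l : i < l -> l <= j.+1 -> (i == 0) && (l == j.+1) = false ->
    H (g i) (g l) = (l == i.+1).
  move=> lt_il le_lj cl; rewrite /g; have ->: i <= j by lia.
  case: leqP => [lj|lj]; first by have [||] := If i l; lia.
  rewrite adj_sym; case: (ltngtP i j) => [ij|ij|->]; try lia.
  rewrite nHxi; lia.
case Hxu: (H x (f 0)).
  have: size (mkseq g j.+2) < 4.
    apply: cH; apply: mkseq_induced_cycle => // i l il lj.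
    case cl: (_ && _); last by rewrite orbF gH.
    by case/andP: cl => /eqP-> /eqP->; rewrite orbT /g /= ltnn adj_sym.
  by rewrite size_mkseq; lia.
apply: (IH g j.+1) => //.
- move=> i l il lj; split; first exact: gN.
  case cl: ((i == 0) && (l == j.+1)); last exact: gH.
  by case/andP: cl => /eqP-> /eqP->; rewrite /g /= ltnn adj_sym Hxu; lia.
- move=> i i0; rewrite ltnS => ij; rewrite /g /= ltnn ij.
  case: (ltngtP i k) => [ik|ik|Di]; [|lia|].
    by have [ui vi] := lowf i i0 ik; split; lia.
  by rewrite Di; split; lia.
- by rewrite /g /=; lia.
- by rewrite /g ltnn; lia.
Qed.

(** Non-adjacent earlier neighbours [b] and [c] of [a] give the path
    [b - a - c], excluded by [no_valley]. *)
Lemma mcs_perfect O : chordal H -> injective O -> mcs_order O -> perfect O.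
Proof.
move=> cH injO mO a b c Hab Hac ba ca nbc; apply/negPn/negP => nHbc.
pose f i := match i with 0 => b | 1 => a | _ => c end.
apply: (@no_valley O cH injO mO (maxn (O b) (O c)).+1 f 2); rewrite //= ?ltnS.
- have nz u v : H u v -> u != v by apply: contraTneq => ->; rewrite adj_irr.
  have Hba : H b a by rewrite adj_sym.
  by move=> [|[|i]] [|[|[|j]]] //= _ _; split;
    rewrite ?nbc ?(nz _ _ Hba) ?(nz _ _ Hac) ?(negPf nHbc).
- by case=> [|[|i]].
- exact: leq_maxl.
- exact: leq_maxr.
Qed.

End EliminationOrders.

(** * A language of bounded loops *)

(** [PFor x c] runs [c] for [x = 0, ..., n - 1], where [n] is the content of
    [rN]. *)
Inductive prog :=
| PAssign (x : nat) (e : expr)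
| PPut (a : nat) (i j e : expr)
| PSeq (c d : prog)
| PIf (b : bexpr) (c : prog)
| PFor (x : nat) (c : prog).

Definition incr x := Assign x (Succ (Reg x)).

Fixpoint compile c : cmd :=
  match c with
  | PAssign x e => Assign x e
  | PPut a i j e => Put a i j e
  | PSeq c d => Seq (compile c) (compile d)
  | PIf b c => If b (compile c) Skip
  | PFor x c => Seq (Assign x (Cst 0))
      (While (BLt (Reg x) (Reg rN)) (Seq (compile c) (incr x)))
  end.

Definition incr_reg x s := set_reg s x (reg s x).+1.

(** The counter is incremented as the compiled loop does it, so that [den]
    gives the final state of the machine on the nose. *)
Fixpoint den c s : state :=
  match c with
  | PAssign x e => set_reg s x (eval s e)
  | PPut a i j e => set_arr s a (eval s i) (eval s j) (eval s e)
  | PSeq c d => den d (den c s)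
  | PIf b c => if beval s b then den c s else s
  | PFor x c => iter (reg s rN) (fun s' => incr_reg x (den c s')) (set_reg s x 0)
  end.

Lemma den_seq c d s : den (PSeq c d) s = den d (den c s).
Proof. by []. Qed.

Fixpoint wregs c : seq nat :=
  match c with
  | PAssign x _ => [:: x]
  | PPut _ _ _ _ => [::]
  | PSeq c d => wregs c ++ wregs d
  | PIf _ c => wregs c
  | PFor x c => x :: wregs c
  end.

Fixpoint warrs c : seq nat :=
  match c with
  | PAssign _ _ => [::]
  | PPut a _ _ _ => [:: a]
  | PSeq c d => warrs c ++ warrs d
  | PIf _ c | PFor _ c => warrs c
  end.

(** Under these conditions the number of iterations of a loop is known when the
    loop is entered. *)
Fixpoint wf c : bool :=
  match c with
  | PAssign x _ => x != rN
  | PPut _ _ _ _ => true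
  | PSeq c d => wf c && wf d
  | PIf _ c => wf c
  | PFor x c => [&& x != rN, x \notin wregs c & wf c]
  end.

Fixpoint depth c : nat :=
  match c with
  | PAssign _ _ | PPut _ _ _ _ => 0
  | PSeq c d => maxn (depth c) (depth d)
  | PIf _ c => depth c
  | PFor _ c => (depth c).+1
  end.

Definition frame c s s' : Prop :=
  (forall x, x \notin wregs c -> reg s' x = reg s x) /\
  (forall a, a \notin warrs c -> arr s' a = arr s a).

Lemma den_frame c s : frame c s (den c s).
Proof.
elim: c s => [x e|a i j e|c IHc d IHd|b c IHc|x c IHc] s /=; split=> //=.
- by move=> y; rewrite inE => /negPf->.
- by move=> y; rewrite inE => /negPf->.
- move=> y; rewrite mem_cat negb_or => /andP[yc yd].
  by rewrite (proj1 (IHd _)) // (proj1 (IHc _)).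
- move=> y; rewrite mem_cat negb_or => /andP[yc yd].
  by rewrite (proj2 (IHd _)) // (proj2 (IHc _)).
- by case: ifP => // _; apply: (proj1 (IHc s)).
- by case: ifP => // _; apply: (proj2 (IHc s)).
- move=> y; rewrite inE negb_or => /andP[/negPf yx yc].
  elim: (reg s rN) => [|m IHm] /=; rewrite yx //.
  by rewrite (proj1 (IHc _)).
- move=> a ac; elim: (reg s rN) => [|m IHm] //=.
  by rewrite (proj2 (IHc _)).
Qed.

Lemma wf_rN c : wf c -> rN \notin wregs c.
Proof.
elim: c => //= [x e|c IHc d IHd|x c IHc].
- by rewrite inE eq_sym.
- by case/andP=> /IHc rc /IHd rd; rewrite mem_cat negb_or rc.
- by case/and3P=> xN _ /IHc rc; rewrite inE negb_or eq_sym xN.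
Qed.

Lemma den_rN c s : wf c -> reg (den c s) rN = reg s rN.
Proof. by move=> /wf_rN rc; apply: (proj1 (den_frame c s)). Qed.

(** The frame hypothesis keeps invariants short: the iterations see the
    registers and arrays that the loop does not write at their values before
    the loop. *)
Lemma for_inv (I : nat -> state -> Prop) x c s : wf (PFor x c) ->
    I 0 (set_reg s x 0) ->
    (forall i s', i < reg s rN -> reg s' x = i -> frame (PFor x c) s s' ->
       I i s' -> I i.+1 (set_reg (den c s') x i.+1)) ->
  I (reg s rN) (den (PFor x c) s).
Proof.
move=> /= /and3P[xN xc wc] I0 IS.
set step := fun s' => incr_reg x (den c s').
suff W m : m <= reg s rN -> [/\ I m (iter m step (set_reg s x 0)),
    reg (iter m step (set_reg s x 0)) x = m &
    frame (PFor x c) s (iter m step (set_reg s x 0))].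
  by case: (W (reg s rN)).
elim: m => [|m IH] le_m.
  split=> //=; first by rewrite eqxx.
  by split=> //= y; rewrite inE negb_or => /andP[/negPf-> _].
have [|Im xm Fm] := IH; first exact: ltnW.
have [F1 F2] := Fm; have [D1 D2] := den_frame c (iter m step (set_reg s x 0)).
rewrite iterS /step /incr_reg -/step (D1 x) // xm; split.
- exact: IS.
- by rewrite /= eqxx.
- split=> [y|a ac] /=; last by rewrite D2 ?F2.
  by rewrite inE negb_or => /andP[yx yc]; rewrite (negPf yx) D1 // F1 // inE negb_or yx.
Qed.

(** Straight-line code takes constant time, and each level of loop nesting
    multiplies the time by at most [n + 1], up to a constant; for
    [n = 0] a loop still tests its condition once. *)
Lemma run_ok c : wf c -> exists C, forall s,
  exists2 t, exec (compile c) s t (den c s) & t <= C * (reg s rN).+1 ^ depth c.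
Proof.
elim: c => [x e|a i j e|c IHc d IHd|b c IHc|x c IHc] /=.
- move=> _; exists (cost e).+1 => s.
  by exists (cost e).+1; [apply: ExecAssign | rewrite muln1].
- move=> _; exists (cost i + cost j + cost e).+1 => s.
  by exists (cost i + cost j + cost e).+1; [apply: ExecPut | rewrite muln1].
- case/andP=> wc wd; have [C runc] := IHc wc; have [D rund] := IHd wd.
  exists (C + D) => s; have [t ex_t le_t] := runc s.
  have [u ex_u le_u] := rund (den c s); rewrite den_rN // in le_u.
  exists (t + u); first exact: ExecSeq ex_t ex_u.
  rewrite mulnDl leq_add //; [apply: leq_trans le_t _ | apply: leq_trans le_u _];
    by rewrite leq_mul2l leq_pexp2l ?leq_maxl ?leq_maxr ?orbT.
- move=> wc; have [C runc] := IHc wc; exists (C + bcost b + 2) => s.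
  have n_gt0 : 0 < (reg s rN).+1 ^ depth c by rewrite expn_gt0.
  case: ifP => [bT|/negbT bF].
    have [t ex_t le_t] := runc s.
    by exists (bcost b + t).+1; [apply: ExecIfTrue ex_t | nia].
  exists (bcost b + 1).+1; last by nia.
  by apply: ExecIfFalse => //; apply: ExecSkip.
- case/and3P=> xN xc wc; have [C runc] := IHc wc; exists (C + 13) => s.
  set n := reg s rN; set B := C * n.+1 ^ depth c.
  have loop d s0 : reg s0 rN = n -> reg s0 x + d = n -> exists2 t,
      exec (While (BLt (Reg x) (Reg rN)) (Seq (compile c) (incr x))) s0 t
        (iter d (fun s' => incr_reg x (den c s')) s0)
      & t <= d * (B + 7) + 4.
    elim: d s0 => [|d IHd] s0 s0N s0x.
      exists 4 => //; apply: (@ExecWhileFalse (BLt (Reg x) (Reg rN))) => /=.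
      by rewrite -leqNgt s0N -s0x addn0.
    have [t ex_t le_t] := runc s0; rewrite s0N -/B in le_t.
    have [D1 _] := den_frame c s0.
    have [||u ex_u le_u] := IHd (incr_reg x (den c s0)).
    - by rewrite /= eq_sym (negPf xN) den_rN.
    - by rewrite /= eqxx D1 // addSnnS.
    exists (3 + (t + 3) + u).+1; last by nia.
    rewrite iterSr; apply: ExecWhileTrue ex_u; first by rewrite /= s0N -s0x; lia.
    by apply: ExecSeq ex_t _; apply: (ExecAssign x (Succ (Reg x))).
  have [||t ex_t le_t] := loop n (set_reg s x 0).
  - by rewrite /= eq_sym (negPf xN).
  - by rewrite /= eqxx.
  exists (2 + t); first by apply: ExecSeq ex_t; apply: (ExecAssign x (Cst 0)).
  have : 0 < n.+1 ^ depth c by rewrite expn_gt0.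
  move: le_t; rewrite /B expnS; move: (n.+1 ^ depth c) => E; nia.
Qed.

(** For two nested loops whose iterations never destroy what earlier ones have
    established, the order of the iterations is irrelevant. *)
Lemma for2_each (K : (nat -> nat -> nat -> nat) -> Prop)
    (Q : nat -> nat -> (nat -> nat -> nat -> nat) -> Prop) x y c s n :
    wf (PFor x (PFor y c)) -> reg s rN = n -> K (arr s) ->
    (forall i j s', i < n -> j < n -> reg s' x = i -> reg s' y = j ->
       frame (PFor x (PFor y c)) s s' -> K (arr s') ->
       [/\ K (arr (den c s')), Q i j (arr (den c s'))
         & forall i' j', Q i' j' (arr s') -> Q i' j' (arr (den c s'))]) ->
  let s' := den (PFor x (PFor y c)) s in
  K (arr s') /\ forall i j, i < n -> j < n -> Q i j (arr s').
Proof.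
move=> wx sN Ks step.
have xN : x != rN by case/andP: wx.
have wy : wf (PFor y c) by case/and3P: wx.
have yN : y != rN by case/andP: wy.
have xyc : x \notin y :: wregs c by case/and3P: wx.
have Nc : rN \notin [:: x, y & wregs c] := wf_rN wx.
pose I m s' := K (arr s') /\ forall i j, i < m -> j < n -> Q i j (arr s').
have: I (reg s rN) (den (PFor x (PFor y c)) s); last by rewrite sN.
apply: for_inv => // i s1; rewrite sN => lt_in s1x F1 [K1 Q1].
pose J m s' := [/\ K (arr s'), forall i' j, i' < i -> j < n -> Q i' j (arr s')
                  & forall j, j < m -> Q i j (arr s')].
have s1N : reg s1 rN = n by rewrite (proj1 F1).
have: J (reg s1 rN) (den (PFor y c) s1).
  apply: for_inv => // j s2; rewrite s1N => lt_jn s2y F2 [K2 Q2 Q2i].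
  have s2x : reg s2 x = i by rewrite (proj1 F2).
  have F : frame (PFor x (PFor y c)) s s2.
    split=> [z|a ac]; last by rewrite (proj2 F2) ?(proj2 F1).
    move=> zc; rewrite (proj1 F2) ?(proj1 F1) //.
    by move: zc; rewrite inE negb_or => /andP[].
  have [K3 Qij Q3] := step i j s2 lt_in lt_jn s2x s2y F K2.
  split=> // [i' j' lt_i' lt_j'|j']; first exact/Q3/Q2.
  by rewrite ltnS leq_eqVlt => /predU1P[->//|/Q2i/Q3].
case=> K2 Q2 Q2i; split=> // i' j'.
by rewrite ltnS leq_eqVlt => /predU1P[->|]; [rewrite -s1N; apply: Q2i | apply: Q2].
Qed.

(** * Computing the powers of a graph *)

Definition code (V : finType) (x : V) : nat := enum_rank x.

Section Code.
Variable V : finType.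

Lemma code_inj : injective (@code V).
Proof. by move=> x y /val_inj/enum_rank_inj. Qed.

Lemma code_eq (x y : V) : (code x == code y) = (x == y).
Proof. exact: inj_eq code_inj _ _. Qed.

Lemma code_lt (x : V) : code x < #|V|.
Proof. exact: ltn_ord. Qed.

Lemma codeP i : i < #|V| -> exists x : V, i = code x.
Proof. by move=> lt_i; exists (enum_val (Ordinal lt_i)); rewrite /code enum_valK. Qed.

Lemma encodesP M (G : sgraph V) :
  encodes M G <-> forall x y, M (code x) (code y) = G x y.
Proof.
split=> [MG x y | MG i j]; first by rewrite MG !enum_rankK.
by rewrite -MG /code !enum_valK.
Qed.

End Code.

Section FloydWarshall.
Variables (V : finType) (G : sgraph V).
Implicit Types D : V -> V -> nat.

(** Entries that are at least [#|V|] stand for an unknown distance. *)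
Definition sound D := forall x y, D x y < #|V| -> has_walk G (D x y) x y.

(** What the recurrence has achieved once the vertices numbered below [m] have
    been admitted as intermediate vertices. *)
Definition complete m D := forall x y q, path G x (rcons q y) ->
  uniq (x :: rcons q y) -> all (fun z => code z < m) q -> D x y <= (size q).+1.

Lemma uniq_size_card (s : seq V) : uniq s -> size s <= #|V|.
Proof. by move/card_uniqP <-; apply: max_card. Qed.

Lemma has_walkD a b x y z :
  has_walk G a x y -> has_walk G b y z -> has_walk G (a + b) x z.
Proof.
case/existsP=> p /andP[Gp /eqP Dy] /existsP[q /andP[Gq /eqP Dz]].
apply/existsP; exists [tuple of p ++ q] => /=.
by rewrite cat_path last_cat Dy Gp Gq Dz eqxx.
Qed.

(** A simple path passes at most once through [z], which splits it into two
    paths through vertices with smaller numbers. *)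
Lemma complete_step D0 D z : complete (code z) D0 ->
    (forall x y, D x y <= D0 x y) ->
    (forall x y, D0 x z < #|V| -> D0 z y < #|V| -> D x y <= D0 x z + D0 z y) ->
  complete (code z).+1 D.
Proof.
move=> cD0 leD relax x y q Gq Uq qz.
have qz' q' : {subset q' <= q} -> z \notin q' -> all (fun u => code u < code z) q'.
  move=> sq zq'; apply/allP => u uq'; have /= := allP qz _ (sq _ uq').
  rewrite ltnS leq_eqVlt code_eq => /predU1P[Du|//].
  by rewrite -Du uq' in zq'.
case: (boolP (z \in q)) => [zq|zq]; last first.
  by apply: leq_trans (leD x y) (cD0 _ _ _ Gq Uq _); apply: qz'.
have [q1 [q2 Dq]] : exists q1 q2, q = q1 ++ z :: q2.
  by case/splitPr: zq => q1 q2; exists q1, q2.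
have Eq : rcons q y = rcons q1 z ++ rcons q2 y.
  by rewrite Dq rcons_cat cat_rcons.
move: Gq Uq; rewrite Eq -cat_cons cat_path last_rcons cat_uniq.
case/andP=> Gq1 Gq2 /and3P[Uq1 dis Uq2].
have zq2 : z \notin rcons q2 y.
  by apply: contra dis => zq2; apply/hasP; exists z => //;
    rewrite inE mem_rcons mem_head orbT.
have zq1 : z \notin q1 by move: Uq1; rewrite /= rcons_uniq => /and3P[].
have D1 : D0 x z <= (size q1).+1.
  by apply: cD0 => //; apply: qz' => // u; rewrite Dq mem_cat => ->.
have D2 : D0 z y <= (size q2).+1.
  apply: cD0; rewrite //= ?zq2 //; apply: qz'.
    by move=> u; rewrite Dq mem_cat inE => ->; rewrite !orbT.
  by apply: contra zq2; rewrite mem_rcons inE => ->; rewrite orbT.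
have := uniq_size_card Uq1; have : size (z :: rcons q2 y) <= #|V|.
  by apply: uniq_size_card; rewrite /= zq2.
rewrite /= !size_rcons => lt2 lt1.
apply: leq_trans (relax x y _ _) _.
- exact: leq_ltn_trans D1 lt1.
- exact: leq_ltn_trans D2 lt2.
by rewrite Dq size_cat -addSn leq_add.
Qed.

(** A shortest walk is simple, hence has fewer than [#|V|] edges and is seen by
    [complete]. *)
Lemma power_of_distances D k x y : sound D -> complete #|V| D ->
  power G k x y = [&& x != y, D x y < #|V| & D x y <= k].
Proof.
move=> sD cD /=; case: eqVneq => //= nxy; apply/dist_leP/andP=> [[d le_dk]|[lt_D le_D]].
  case/existsP=> p /andP[Gp /eqP Dy].
  move: (size_tuple p) nxy Gp Dy; case: p => p /= _ sz_p nxy Gp Dy.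
  case/shortenP: Gp Dy => p' Gp' Up' sub_p' Dy.
  have szp' : size p' <= size p by apply: uniq_leq_size sub_p'; case/andP: Up'.
  case/lastP: p' => [|q y'] in Gp' Up' sub_p' szp' Dy *; first by rewrite -Dy eqxx in nxy.
  rewrite last_rcons in Dy; rewrite {y'}Dy in Gp' Up' sub_p' szp'.
  have le_Dq : D x y <= (size q).+1.
    by apply: cD => //; apply/allP => z _; apply: code_lt.
  have := uniq_size_card Up'; rewrite /= size_rcons => lt_q.
  split; first exact: leq_ltn_trans le_Dq lt_q.
  by apply: leq_trans le_dk; rewrite -sz_p; apply: leq_trans le_Dq _; rewrite -(size_rcons q y).
by exists (D x y); rewrite ?sD.
Qed.

End FloydWarshall.

Definition rI := 3.
Definition rJ := 4.
Definition rM := 5.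
Definition aD := 2.
Definition aA := 3.

(** The machine has no addition.  Only sums of two known distances are
    needed, so the summands may be restricted to numbers below [n]. *)
Definition tabulate_sums : prog :=
  PFor rI (PSeq (PPut aA (Reg rI) (Cst 0) (Reg rI))
    (PFor rJ (PPut aA (Reg rI) (Succ (Reg rJ)) (Succ (Get aA (Reg rI) (Reg rJ)))))).

Definition fill a e b : prog :=
  PFor rI (PFor rJ (PSeq (PPut a (Reg rI) (Reg rJ) e)
    (PIf b (PPut a (Reg rI) (Reg rJ) (Cst 1))))).

Definition init_distances : prog :=
  fill aD (Reg rN) (BEq (Get aG (Reg rI) (Reg rJ)) (Cst 1)).

Definition detour : expr :=
  Get aA (Get aD (Reg rI) (Reg rM)) (Get aD (Reg rM) (Reg rJ)).

Definition relax : prog :=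
  PIf (BAnd (BLt (Get aD (Reg rI) (Reg rM)) (Reg rN))
      (BAnd (BLt (Get aD (Reg rM) (Reg rJ)) (Reg rN))
            (BLt detour (Get aD (Reg rI) (Reg rJ)))))
    (PPut aD (Reg rI) (Reg rJ) detour).

Definition relax_all : prog := PFor rM (PFor rI (PFor rJ relax)).

(** The exponent may exceed [n], so that known distances still have to be told
    apart from the entries [n] of unreachable pairs. *)
Definition threshold : prog :=
  fill aP (Cst 0)
    (BAnd (BNot (BEq (Reg rI) (Reg rJ)))
    (BAnd (BLt (Get aD (Reg rI) (Reg rJ)) (Reg rN))
          (BLt (Get aD (Reg rI) (Reg rJ)) (Succ (Reg rK))))).

Definition power_prog : prog :=
  PSeq tabulate_sums (PSeq init_distances (PSeq relax_all threshold)).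

Lemma tabulate_sumsP s i j : i < reg s rN -> j < reg s rN ->
  arr (den tabulate_sums s) aA i j = i + j.
Proof.
move=> lt_i lt_j.
pose I m s' := forall i j, i < m -> j < reg s rN -> arr s' aA i j = i + j.
suff /(_ i j) : I (reg s rN) (den tabulate_sums s) by apply.
apply: for_inv => // {lt_i lt_j}i s1 lt_i s1i F1 I1.
pose J m s' := (forall i' j, i' < i -> j < reg s rN -> arr s' aA i' j = i' + j) /\
   (forall j, j <= m -> arr s' aA i j = i + j).
set s2 := set_arr s1 aA i 0 i.
have s2N : reg s2 rN = reg s rN by apply: (proj1 F1).
rewrite /= s1i -/s2.
have: J (reg s2 rN) (den (PFor rJ (PPut aA (Reg rI) (Succ (Reg rJ))
    (Succ (Get aA (Reg rI) (Reg rJ))))) s2).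
  apply: for_inv => //.
    split=> [i' j' lt_i' lt_j'|j'] /=; last by rewrite leqn0 => /eqP->; rewrite eqxx addn0.
    by rewrite ifN ?I1 // negb_and; lia.
  move=> {}j s3 lt_j s3j F3 [J1 J2].
  have s3i : reg s3 rI = i by rewrite (proj1 F3).
  rewrite /= s3i s3j J2 //; split=> [i' j' lt_i' lt_j'|j' le_j'] /=.
    by rewrite ifN ?J1 // negb_and; lia.
  rewrite eqxx /=; case: eqP => [->|ne]; first by rewrite addnS.
  by apply: J2; lia.
rewrite s2N; case=> J1 J2 i' j'; rewrite ltnS leq_eqVlt => /predU1P[->|lt_i'] lt_j'.
  by apply: J2; apply: ltnW.
exact: J1.
Qed.

Lemma fillP a e b s n v (beta : nat -> nat -> bool) : reg s rN = n ->
    (forall i j s', i < n -> j < n -> reg s' rI = i -> reg s' rJ = j ->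
       frame (fill a e b) s s' ->
       eval s' e = v /\ beval (set_arr s' a i j v) b = beta i j) ->
  forall i j, i < n -> j < n ->
    arr (den (fill a e b) s) a i j = if beta i j then 1 else v.
Proof.
move=> sN body.
have [] := @for2_each (fun _ => True)
  (fun i j M => M a i j = if beta i j then 1 else v) _ _ _ s _
  (isT : wf (fill a e b)) sN I; last by [].
move=> i j s' lt_i lt_j s'i s'j F _.
have [ev bv] := body i j s' lt_i lt_j s'i s'j F.
have E i' j' : arr (den (PSeq (PPut a (Reg rI) (Reg rJ) e)
    (PIf b (PPut a (Reg rI) (Reg rJ) (Cst 1)))) s') a i' j' =
  if (i' == i) && (j' == j) then if beta i j then 1 else v else arr s' a i' j'.
  rewrite [den _ _]/= s'i s'j ev bv; case: (beta i j); last by rewrite /= eqxx.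
  by rewrite /= !eqxx; case: (_ && _).
split=> // [|i' j' Ea]; rewrite E ?eqxx //.
by case: ifP => // /andP[/eqP-> /eqP->].
Qed.

Section PowerProgram.
Variables (V : finType) (G : sgraph V).

Definition entry (s : state) (a : nat) (x y : V) : nat := arr s a (code x) (code y).

Lemma init_distancesP s x y : is_input G s ->
  entry (den init_distances s) aD x y = if G x y then 1 else #|V|.
Proof.
case=> sN /encodesP sG.
rewrite /entry (fillP (v := #|V|) (beta := fun i j => arr s aG i j == 1) sN) ?code_lt //.
  by rewrite sG; case: (G x y).
move=> i j s' _ _ s'i s'j F; split; first by rewrite /= (proj1 F).
by rewrite /= s'i s'j (proj2 F).
Qed.

Lemma thresholdP s x y : reg s rN = #|V| -> entry (den threshold s) aP x y =
  [&& x != y, entry s aD x y < #|V| & entry s aD x y <= reg s rK].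
Proof.
move=> sN; rewrite /entry (fillP (v := 0)
  (beta := fun i j => [&& i != j, arr s aD i j < #|V| & arr s aD i j <= reg s rK]) sN)
  ?code_lt //.
  by rewrite code_eq; case: ifP.
move=> i j s' _ _ s'i s'j F; split=> //.
by rewrite /= s'i s'j !(proj2 F) // !(proj1 F) // sN.
Qed.

(** The matrix is updated in place, hence the entries in row and column [z] may
    change during the round.  This is harmless: entries only decrease and
    remain sound, while [complete_step] needs no more than upper bounds in terms
    of the matrix [D0] at the start of the round. *)
Lemma relax_round s (z : V) : reg s rN = #|V| -> reg s rM = code z ->
    (forall i j, i < #|V| -> j < #|V| -> arr s aA i j = i + j) ->
    sound G (entry s aD) -> complete G (code z) (entry s aD) ->
  let s' := den (PFor rI (PFor rJ relax)) s in
  sound G (entry s' aD) /\ complete G (code z).+1 (entry s' aD).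
Proof.
move=> sN sM sA sd cp s'; set D0 := entry s aD.
pose K (M : nat -> nat -> nat -> nat) :=
  (forall x y, M aD (code x) (code y) <= D0 x y) /\
  sound G (fun x y => M aD (code x) (code y)).
pose Q i j (M : nat -> nat -> nat -> nat) :=
  forall x y, i = code x -> j = code y -> D0 x z < #|V| -> D0 z y < #|V| ->
  M aD i j <= D0 x z + D0 z y.
have [||[leD sd'] relaxed] := @for2_each K Q rI rJ relax s _ isT sN.
- by split=> // x y.
- move=> i j s1 lt_i lt_j s1i s1j F [leD sd1].
  have [x Dx] := codeP lt_i; have [y Dy] := codeP lt_j.
  have s1N : reg s1 rN = #|V| by rewrite (proj1 F).
  have s1M : reg s1 rM = code z by rewrite (proj1 F).
  have s1A : arr s1 aA = arr s aA by rewrite (proj2 F).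
  have relaxE : den relax s1 =
      if [&& entry s1 aD x z < #|V|, entry s1 aD z y < #|V| &
             entry s1 aD x z + entry s1 aD z y < entry s1 aD x y]
      then set_arr s1 aD (code x) (code y) (entry s1 aD x z + entry s1 aD z y)
      else s1.
    rewrite /= s1i s1j s1N s1M s1A Dx Dy -!/(entry _ _ _ _).
    by case: ltnP => //= lt1; case: ltnP => //= lt2; rewrite sA.
  have stays i' j' : arr (den relax s1) aD i' j' <= arr s1 aD i' j'.
    rewrite relaxE; case: ifP => // /and3P[_ _ lt3] /=.
    by case: ifP => // /andP[/eqP-> /eqP->]; apply: ltnW.
  have relaxxy : entry s1 aD x z < #|V| -> entry s1 aD z y < #|V| ->
      entry (den relax s1) aD x y <= entry s1 aD x z + entry s1 aD z y.
    move=> lt1 lt2; rewrite relaxE lt1 lt2 /=.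
    by case: ltnP => [lt3|//]; rewrite {1}/entry /= !eqxx.
  have le1 u v : entry s1 aD u v <= D0 u v by apply: leD.
  split.
  + split=> [u v|u v]; first exact: leq_trans (stays _ _) (leD u v).
    rewrite relaxE; case: ifP => [/and3P[lt1 lt2 lt3]|_]; last exact: sd1.
    rewrite /= !code_eq; case: ifP => [/andP[/eqP-> /eqP->]|_]; last exact: sd1.
    by move=> _; apply: has_walkD; apply: sd1.
  + move=> u v; rewrite Dx Dy => /code_inj <- /code_inj <- lt1 lt2.
    apply: leq_trans (relaxxy _ _) (leq_add (le1 _ _) (le1 _ _)).
      exact: leq_ltn_trans (le1 _ _) lt1.
    exact: leq_ltn_trans (le1 _ _) lt2.
  + move=> i' j' Qs u v Du Dv lt1 lt2; apply: leq_trans (stays _ _) _.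
    exact: Qs.
split; first exact: sd'.
apply: complete_step cp leD _ => x y lt1 lt2.
by apply: (relaxed (code x) (code y)); rewrite ?code_lt.
Qed.

Lemma relax_allP s : reg s rN = #|V| ->
    (forall i j, i < #|V| -> j < #|V| -> arr s aA i j = i + j) ->
    sound G (entry s aD) -> complete G 0 (entry s aD) ->
  let s' := den relax_all s in
  sound G (entry s' aD) /\ complete G #|V| (entry s' aD).
Proof.
move=> sN sA sd cp; rewrite -sN.
apply: (for_inv (I := fun m s' => sound G (entry s' aD) /\ complete G m (entry s' aD))) => //.
rewrite sN => m s1 lt_m s1M F [sd1 cp1].
have [z Dz] := codeP lt_m; rewrite Dz in s1M cp1 *.
apply: relax_round => //; first by rewrite (proj1 F).
by rewrite (proj2 F).
Qed.

End PowerProgram.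

Lemma power_progP (V : finType) (G : sgraph V) s : is_input G s ->
  encodes (arr (den power_prog s) aP) (power G (reg s rK)).
Proof.
move=> sG; have [sN sE] := sG; apply/encodesP => x y.
rewrite !den_seq; set s1 := den tabulate_sums s; set s2 := den init_distances s1.
set s3 := den relax_all s2.
have F1 : frame _ s s1 := den_frame _ _.
have F2 : frame _ s1 s2 := den_frame _ _.
have F3 : frame _ s2 s3 := den_frame _ _.
have s1N : reg s1 rN = #|V| by rewrite (proj1 F1).
have s2N : reg s2 rN = #|V| by rewrite (proj1 F2).
have s3N : reg s3 rN = #|V| by rewrite (proj1 F3).
have s1G : is_input G s1 by split=> //; rewrite (proj2 F1).
have s2A i j : i < #|V| -> j < #|V| -> arr s2 aA i j = i + j.
  by move=> lt_i lt_j; rewrite (proj2 F2) // tabulate_sumsP ?sN.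
have s2D u v : entry s2 aD u v = if G u v then 1 else #|V| by apply: init_distancesP.
have [||sd cp] := @relax_allP _ G s2 s2N s2A.
- move=> u v; rewrite s2D; case: ifP => [Guv _|]; last by rewrite ltnn.
  by apply/existsP; exists [tuple v]; rewrite /= Guv eqxx.
- move=> u v [|w q] Gq _ //= _.
  by rewrite s2D; case/andP: Gq => ->.
rewrite -/(entry _ _ _ _) thresholdP // -(power_of_distances _ _ _ sd cp).
by rewrite (proj1 F3) // (proj1 F2) // (proj1 F1).
Qed.

(** * Testing chordality *)

Section Search.
Variables (V : finType) (H : sgraph V).

(** The state of the search after [r] rounds: [O] numbers the visited vertices
    by [0, ..., r - 1] and is [#|V|] elsewhere; [W] counts visited neighbours. *)
Record search_inv (O W : V -> nat) (r : nat) : Prop := SearchInv {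
  visited_or_not : forall x, O x < r \/ O x = #|V|;
  visited_inj : forall x y, O x < r -> O x = O y -> x = y;
  visited_card : #|[set x | O x < r]| = r;
  weightE : forall x, W x = #|[set y | (O y < r) && H y x]|;
  preferred : forall v w, O v < r -> O v < O w ->
    #|[set x | (O x < O v) && H x w]| <= #|[set x | (O x < O v) && H x v]|
}.

Lemma search_unvisited O W r : search_inv O W r -> r < #|V| ->
  exists x, O x = #|V|.
Proof.
case=> vis _ card _ _ lt_r.
have: ~~ ([set: V] \subset [set x | O x < r]).
  by apply/negP => /subset_leq_card; rewrite card cardsT leqNgt lt_r.
case/subsetPn=> x _; rewrite inE => nx; exists x.
by case: (vis x) => // lt_x; rewrite lt_x in nx.
Qed.

(** Visiting [m] moves its number from [#|V|] to [r], and hence affects no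
    comparison with a number that is at most [r]: the counts involved in
    [preferred] for the vertices visited before do not change. *)
Lemma search_step O W O' W' r m : search_inv O W r -> r < #|V| -> O m = #|V| ->
    (forall v, O v = #|V| -> W v <= W m) ->
    (forall x, O' x = if x == m then r else O x) ->
    (forall x, W' x = W x + H m x) ->
  search_inv O' W' r.+1.
Proof.
move=> [vis inj card wt pref] lt_r Om maxm O'E W'E.
have lowE x k : k <= r -> (O' x < k) = (O x < k).
  by move=> le_k; rewrite O'E; case: eqP => // ->; rewrite Om; lia.
have setE k (P : pred V) : k <= r ->
    [set x | (O' x < k) && P x] = [set x | (O x < k) && P x].
  by move=> le_k; apply/setP => x; rewrite !inE lowE.
have lowS x : (O' x < r.+1) = (x == m) || (O x < r).
  rewrite O'E; case: eqP => [_|nxm]; first by rewrite ltnSn.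
  by rewrite ltnS; case: (vis x); lia.
split.
- move=> x; rewrite lowS O'E; case: eqP => [|_]; [by left|exact: vis].
- move=> x y; rewrite lowS !O'E; case: (eqVneq x m) (eqVneq y m) => [->|nx] [->|ny] //=.
  + by move=> _ Dr; case: (vis y); lia.
  + by move=> lt_x Dx; rewrite Dx ltnn in lt_x.
  + exact: inj.
- have ->: [set x | O' x < r.+1] = m |: [set x | O x < r].
    by apply/setP => x; rewrite !inE lowS.
  by rewrite cardsU1 inE Om card ltnNge ltnW.
- move=> x; rewrite W'E wt.
  have ->: [set y | (O' y < r.+1) && H y x] =
      [set y | (y == m) && H m x] :|: [set y | (O y < r) && H y x].
    apply/setP => y; rewrite !inE lowS; case: eqP => //= ->.
    by rewrite Om; case: (H m x); rewrite ?andbF.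
  rewrite cardsU addnC.
  have ->: [set y | (y == m) && H m x] :&: [set y | (O y < r) && H y x] = set0.
    apply/setP => y; rewrite !inE; case: eqP => //= ->.
    by rewrite Om ltnNge ltnW // andbF.
  rewrite cards0 subn0; congr (_ + _); case: (H m x) => /=.
    by rewrite -(cards1 m); apply: eq_card => y; rewrite !inE andbT.
  by apply/esym/eqP; rewrite cards_eq0; apply/eqP/setP => y; rewrite !inE andbF.
- move=> v w; rewrite lowS [O' v]O'E; case: eqP => [->|nv] /=.
    move=> _; rewrite O'E; case: eqP => [|nw lt_w]; first by rewrite ltnn.
    rewrite !setE // -!wt; apply: maxm; case: (vis w) => //; lia.
  move=> lt_v; rewrite O'E => lt_vw; rewrite !setE ?(ltnW lt_v) //.
  apply: pref => //; case: eqP lt_vw => // -> _; rewrite Om; lia.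
Qed.

Lemma search_done O W : search_inv O W #|V| -> injective O /\ mcs_order H O.
Proof.
case=> vis inj card _ pref.
have all_vis x : O x < #|V|.
  have: [set x | O x < #|V|] == [set: V].
    by rewrite eqEcard subsetT cardsT card leqnn.
  by move/eqP/setP/(_ x); rewrite !inE.
by split=> [x y|v w]; [apply: inj | apply: pref].
Qed.

End Search.

Definition aW := 4.
Definition aO := 5.

Definition init_search : prog :=
  PFor rI (PSeq (PPut aO (Reg rI) (Cst 0) (Reg rN)) (PPut aW (Reg rI) (Cst 0) (Cst 0))).

Definition better : bexpr :=
  BAnd (BEq (Get aO (Reg rJ) (Cst 0)) (Reg rN))
       (BNot (BAnd (BLt (Reg rM) (Reg rN))
             (BNot (BLt (Get aW (Reg rM) (Cst 0)) (Get aW (Reg rJ) (Cst 0)))))).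

(** [rM] holds the heaviest unvisited vertex so far, where [n] stands for
    none. *)
Definition pick : prog :=
  PSeq (PAssign rM (Reg rN)) (PFor rJ (PIf better (PAssign rM (Reg rJ)))).

Definition add_weights : prog :=
  PFor rJ (PIf (BEq (Get aP (Reg rM) (Reg rJ)) (Cst 1))
    (PPut aW (Reg rJ) (Cst 0) (Succ (Get aW (Reg rJ) (Cst 0))))).

Definition visit : prog := PSeq (PPut aO (Reg rM) (Cst 0) (Reg rI)) add_weights.

Definition search : prog := PFor rI (PSeq pick visit).

Definition nonadjacent_earlier : bexpr :=
  BAnd (BEq (Get aP (Reg rI) (Reg rJ)) (Cst 1))
 (BAnd (BEq (Get aP (Reg rI) (Reg rM)) (Cst 1))
 (BAnd (BLt (Get aO (Reg rJ) (Cst 0)) (Get aO (Reg rI) (Cst 0)))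
 (BAnd (BLt (Get aO (Reg rM) (Cst 0)) (Get aO (Reg rI) (Cst 0)))
 (BAnd (BNot (BEq (Reg rJ) (Reg rM)))
       (BNot (BEq (Get aP (Reg rJ) (Reg rM)) (Cst 1))))))).

Definition check : prog :=
  PFor rI (PFor rJ (PFor rM (PIf nonadjacent_earlier (PAssign rAns (Cst 0))))).

Definition test_prog : prog :=
  PSeq init_search (PSeq search (PSeq (PAssign rAns (Cst 1)) check)).

(** Multiplication of truth values is conjunction, and as a statement about
    [rAns] alone the rule applies to itself: nested three times it evaluates
    [check]. *)
Lemma for_all (b : nat -> bool) x c s : wf (PFor x c) -> x != rAns ->
    (forall i s', i < reg s rN -> reg s' x = i -> frame (PFor x c) s s' ->
       reg (den c s') rAns = reg s' rAns * b i) ->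
  reg (den (PFor x c) s) rAns = reg s rAns * all b (iota 0 (reg s rN)).
Proof.
move=> wc xA body.
apply: (for_inv (I := fun i s' => reg s' rAns = reg s rAns * all b (iota 0 i))) => //.
  by rewrite /= eq_sym (negPf xA) muln1.
move=> i s' lt_i s'x F E; rewrite [LHS]/= eq_sym (negPf xA) (body i) // E.
by rewrite -addn1 iotaD all_cat /= andbT -mulnA mulnb.
Qed.

Section SearchProgram.
Variables (V : finType) (H : sgraph V).

Definition pos (s : state) (x : V) : nat := arr s aO (code x) 0.
Definition weight (s : state) (x : V) : nat := arr s aW (code x) 0.

Lemma init_searchP s : reg s rN = #|V| ->
  let s' := den init_search s in search_inv H (pos s') (weight s') 0.
Proof.
move=> sN s'.
have: forall x, code x < reg s rN -> pos s' x = #|V| /\ weight s' x = 0.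
  apply: (for_inv (I := fun i s1 =>
    forall x, code x < i -> pos s1 x = #|V| /\ weight s1 x = 0)) => //.
  move=> i s1 lt_i s1i F IH x; rewrite /pos /weight /= s1i eqxx andbT (proj1 F) //.
  rewrite ltnS leq_eqVlt; case: eqP => //= _; exact: IH.
rewrite sN => init; split=> //.
- by move=> x; right; case: (init x (code_lt x)).
- by apply/eqP; rewrite cards_eq0; apply/eqP/setP => x; rewrite !inE ltn0.
- move=> x; have [_ ->] := init x (code_lt x); apply/esym/eqP; rewrite cards_eq0.
  by apply/eqP/setP => y; rewrite !inE ltn0.
Qed.

Lemma pickP s : reg s rN = #|V| -> (exists x : V, pos s x = #|V|) ->
  exists2 m : V, reg (den pick s) rM = code m &
    pos s m = #|V| /\ forall v : V, pos s v = #|V| -> weight s v <= weight s m.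
Proof.
move=> sN [x0 x0_new]; rewrite /pick den_seq.
set s1 := den (PAssign rM (Reg rN)) s.
pose I i s' :=
  (reg s' rM < #|V| -> arr s aO (reg s' rM) 0 = #|V|) /\
  forall v : V, code v < i -> pos s v = #|V| ->
    reg s' rM < #|V| /\ weight s v <= arr s aW (reg s' rM) 0.
have: I (reg s1 rN) (den (PFor rJ (PIf better (PAssign rM (Reg rJ)))) s1).
  apply: for_inv => //; first by split=> //=; rewrite sN ltnn.
  move=> j s2 lt_j s2j F [I1 I2].
  have s2N : reg s2 rN = #|V| by rewrite (proj1 F).
  have s2O : arr s2 aO = arr s aO by rewrite (proj2 F).
  have s2W : arr s2 aW = arr s aW by rewrite (proj2 F).
  have E : reg (den (PIf better (PAssign rM (Reg rJ))) s2) rM =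
    if (arr s aO j 0 == #|V|) && ~~ ((reg s2 rM < #|V|) &&
       ~~ (arr s aW (reg s2 rM) 0 < arr s aW j 0)) then j else reg s2 rM.
    by rewrite /= s2j s2N s2O s2W; case: ifP => // _ /=; rewrite s2j.
  rewrite /I [reg (set_reg _ _ _) _]E.
  have [x Dx] : exists x : V, j = code x by apply: codeP; rewrite -sN.
  rewrite {}Dx in lt_j s2j I2 E *.
  case: ifP => [/andP[/eqP xnew better_x]|worse_x]; split=> //.
  - move=> v; rewrite ltnS leq_eqVlt code_eq => /predU1P[->|lt_v] vnew.
      by rewrite code_lt.
    have [lt_M le_vM] := I2 v lt_v vnew; rewrite code_lt; split=> //.
    rewrite lt_M /= negbK in better_x.
    exact: leq_trans le_vM (ltnW better_x).
  - move=> v; rewrite ltnS leq_eqVlt code_eq => /predU1P[->|lt_v] vnew; last exact: I2.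
    move: worse_x; rewrite -/(pos s x) vnew eqxx /= => /negbFE/andP[-> ].
    by rewrite -leqNgt.
rewrite [reg s1 _]sN => -[I1 I2].
have [lt_M _] := I2 x0 (code_lt x0) x0_new.
have [m Dm] := codeP lt_M; exists m; rewrite ?Dm // in I1 I2 *.
by split=> [|v vnew]; [apply: I1; rewrite -?Dm | case: (I2 v (code_lt v) vnew)].
Qed.

Lemma visitP s (m : V) : reg s rN = #|V| -> encodes (arr s aP) H -> reg s rM = code m ->
  let s' := den visit s in
  (forall x : V, pos s' x = if x == m then reg s rI else pos s x) /\
  (forall x : V, weight s' x = weight s x + H m x).
Proof.
move=> sN /encodesP sH sM s'.
have [F1 F2] := den_frame add_weights (set_arr s aO (code m) 0 (reg s rI)).
rewrite /s' /visit den_seq [den (PPut _ _ _ _) s]/= sM.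
set s1 := set_arr _ _ _ _ _ in F1 F2 *.
split=> [x|x]; first by rewrite /pos F2 //= code_eq andbT.
suff: weight (den add_weights s1) x = weight s x + ((code x < reg s1 rN) && H m x).
  by rewrite [reg s1 _]sN code_lt.
apply: (for_inv (I := fun i s' => weight s' x = weight s x + ((code x < i) && H m x))) => //.
  by rewrite ltn0 addn0.
move=> j s2; rewrite [reg s1 _]sN => lt_j s2j F Wx.
have [y Dy] := codeP lt_j; rewrite {j lt_j}Dy in s2j Wx *.
have s2M : reg s2 rM = code m by rewrite (proj1 F).
have s2P : arr s2 aP = arr s aP by rewrite (proj2 F).
rewrite /weight /= s2j s2M s2P sH ltnS leq_eqVlt code_eq.
have -> : (H m y : nat) == 1 = H m y by case: (H m y).
case: (eqVneq x y) => [Dx|nxy].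
  rewrite -Dx ltnn addn0 in Wx *; case: (H m x) => /=.
    by rewrite eqxx -/(weight s2 x) Wx addn1.
  by rewrite -/(weight s2 x) Wx addn0.
case: (H m y) => /=; last exact: Wx.
by rewrite code_eq (negPf nxy); exact: Wx.
Qed.

Lemma searchP s : reg s rN = #|V| -> encodes (arr s aP) H ->
    search_inv H (pos s) (weight s) 0 ->
  let s' := den search s in injective (pos s') /\ mcs_order H (pos s').
Proof.
move=> sN sH inv0 s'; apply: (@search_done _ H _ (weight s')); rewrite -sN.
apply: (for_inv (I := fun r s1 => search_inv H (pos s1) (weight s1) r)) => //.
rewrite sN => r s1 lt_r s1r F inv1; rewrite den_seq.
have s1N : reg s1 rN = #|V| by rewrite (proj1 F).
have [m s2M [m_new m_max]] := pickP s1N (search_unvisited inv1 lt_r).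
have [F1 F2] := den_frame pick s1.
have [||O' W'] := @visitP (den pick s1) m _ _ s2M.
- by rewrite F1.
- by rewrite F2 // (proj2 F).
apply: (search_step inv1 lt_r m_new m_max) => x.
- by apply: etrans (O' x) _; rewrite F1 // s1r /pos F2.
- by apply: etrans (W' x) _; rewrite /weight F2.
Qed.

Lemma checkP s : reg s rN = #|V| -> encodes (arr s aP) H -> reg s rAns = 1 ->
  reg (den check s) rAns <> 0 <-> perfect H (pos s).
Proof.
move=> sN /encodesP sH sA.
pose ok i j k := ~~ [&& arr s aP i j == 1, arr s aP i k == 1,
  arr s aO j 0 < arr s aO i 0, arr s aO k 0 < arr s aO i 0, j != k &
  arr s aP j k != 1].
pose all_n (b : nat -> bool) := all b (iota 0 #|V|).
have ->: reg (den check s) rAns =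
    all_n (fun i => all_n (fun j => all_n (fun k => ok i j k))) :> nat.
  rewrite (@for_all (fun i => all_n (fun j => all_n (fun k => ok i j k)))) //.
    by rewrite sA sN mul1n.
  move=> i s1 _ s1i F1.
  rewrite (@for_all (fun j => all_n (fun k => ok i j k))) //.
    by rewrite [reg s1 rN](proj1 F1) // sN.
  move=> j s2 _ s2j F2.
  rewrite (@for_all (fun k => ok i j k)) //.
    by rewrite [reg s2 rN](proj1 F2) // [reg s1 rN](proj1 F1) // sN.
  move=> k s3 _ s3k F3.
  have s3i : reg s3 rI = i by rewrite (proj1 F3) // (proj1 F2).
  have s3j : reg s3 rJ = j by rewrite (proj1 F3).
  have s3P : arr s3 aP = arr s aP by rewrite (proj2 F3) // (proj2 F2) // (proj2 F1).
  have s3O : arr s3 aO = arr s aO by rewrite (proj2 F3) // (proj2 F2) // (proj2 F1).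
  rewrite /= s3i s3j s3k s3P s3O /ok; case: ifP => _ /=; by rewrite ?muln0 ?muln1.
have all_nP (b : nat -> bool) : reflect (forall x : V, b (code x)) (all_n b).
  apply: (iffP allP) => [b1 x|b1 i]; first by apply: b1; rewrite mem_iota code_lt.
  by rewrite mem_iota => /codeP[x ->].
have b1 (b : bool) : ((b : nat) == 1) = b by case: b.
have okE x y z : ok (code x) (code y) (code z) =
    ~~ [&& H x y, H x z, pos s y < pos s x, pos s z < pos s x, y != z & ~~ H y z].
  by rewrite /ok !sH !b1 code_eq.
split=> [nz a b c Hab Hac ba ca nbc | PO].
  have {nz}: all_n (fun i => all_n (fun j => all_n (fun k => ok i j k))).
    by case: (all_n _) nz.
  move/all_nP/(_ a)/all_nP/(_ b)/all_nP/(_ c).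
  by rewrite okE Hab Hac ba ca nbc /= negbK.
suff ->: all_n (fun i => all_n (fun j => all_n (fun k => ok i j k))) by [].
apply/all_nP => a; apply/all_nP => b; apply/all_nP => c; rewrite okE.
by apply/negP => /and5P[Hab Hac ba ca /andP[nbc /negP[]]]; apply: (PO a).
Qed.

Lemma test_progP s : reg s rN = #|V| -> encodes (arr s aP) H ->
  reg (den test_prog s) rAns <> 0 <-> chordal H.
Proof.
move=> sN sH; rewrite /test_prog !den_seq.
set s1 := den init_search s; set s2 := den search s1.
have F1 : frame _ s s1 := den_frame _ _.
have F2 : frame _ s1 s2 := den_frame _ _.
have s1N : reg s1 rN = #|V| by rewrite (proj1 F1).
have s1H : encodes (arr s1 aP) H by rewrite (proj2 F1).
have [injO mO] := searchP s1N s1H (init_searchP sN).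
rewrite checkP //= ?(proj1 F2) ?(proj2 F2) //.
by split=> [|cH]; [apply: perfect_chordal | apply: mcs_perfect].
Qed.

End SearchProgram.

(** * The algorithm POC *)

(** Such a power joins any two vertices of the same component, so that distinct
    neighbours of a vertex are adjacent. *)
Lemma chordal_last_power (V : finType) (G : sgraph V) k :
  #|V|.-1 <= k -> chordal (power G k).
Proof.
move=> le_k c ic; rewrite ltnNge; apply/negP => c_ge4.
have [a0 a0c] : exists a0, a0 \in c.
  by case: c c_ge4 {ic} => // a0 c _; exists a0; rewrite mem_head.
have [x [y [_ /andP[_ /dist_leP[d _ wx]] /andP[_ /dist_leP[e _ wy]] nxy]]] :=
  induced_cycle_neighbours ic c_ge4 a0c.
case/negP; rewrite /= nxy /=; rewrite has_walk_sym in wx.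
case/existsP: (has_walkD wx wy) => p /andP[Gp /eqP Dy].
case/shortenP: Gp Dy => p' Gp' Up' _ Dy.
apply/dist_leP; exists (size p'); last first.
  by apply/existsP; exists (in_tuple p'); rewrite Gp' Dy eqxx.
by apply: leq_trans le_k; have := uniq_size_card Up'; rewrite /= -ltnS; case: #|V|.
Qed.

Lemma compile_power_prog : computes_power (compile power_prog).
Proof.
move=> V G s sG _; have [C run] := @run_ok power_prog isT.
have [t ex_t _] := run s; have [F1 F2] := den_frame power_prog s.
exists t, (den power_prog s); split=> //; first exact: power_progP.
by split; [apply: F1 | apply: F1 | apply: F2].
Qed.

Lemma compile_test_prog : tests_chordality (compile test_prog).
Proof.
move=> V H s sN sH; have [C run] := @run_ok test_prog isT.
have [t ex_t _] := run s; have [F1 F2] := den_frame test_prog s.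
exists t, (den test_prog s); split=> //; first exact: test_progP.
by split; [apply: F1 | apply: F1 | apply: F2 | apply: F2].
Qed.

Definition poc_test : bexpr :=
  BAnd (BEq (Reg rAns) (Cst 0)) (BLt (Reg rK) (Reg rN)).

Definition poc_body : cmd :=
  Seq (compile power_prog) (Seq (compile test_prog)
    (If (BEq (Reg rAns) (Cst 0)) (Assign rK (Succ (Reg rK))) Skip)).

Lemma poc_round : exists C, forall (V : finType) (G : sgraph V) s, is_input G s ->
  exists t s', [/\ exec poc_body s t s', is_input G s',
    t <= C * #|V|.+1 ^ 3 + 7
    & [/\ chordal (power G (reg s rK)), reg s' rAns <> 0, reg s' rK = reg s rK
         & encodes (arr s' aP) (power G (reg s rK))]
   \/ [/\ ~ chordal (power G (reg s rK)), reg s' rAns = 0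
         & reg s' rK = (reg s rK).+1]].
Proof.
have [C1 run1] := @run_ok power_prog isT; have [C2 run2] := @run_ok test_prog isT.
exists (C1 + C2) => V G s sG; have [sN sE] := sG.
have s1P := power_progP sG.
have [t1 ex1 le1] := run1 s; have [F1 F1'] := den_frame power_prog s.
move: (den _ s) => s1 in ex1 F1 F1' s1P *.
have s1N : reg s1 rN = #|V| by rewrite F1.
have ans := test_progP s1N s1P.
have [t2 ex2 le2] := run2 s1; have [F2 F2'] := den_frame test_prog s1.
move: (den _ s1) => s2 in ex2 F2 F2' ans *.
have s2N : reg s2 rN = #|V| by rewrite F2.
have s2E : encodes (arr s2 aG) G by rewrite F2' // F1'.
have s2K : reg s2 rK = reg s rK by rewrite F2 // F1.
rewrite [depth _]/= s1N in le2; rewrite [depth _]/= sN in le1.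
(* The final conditional costs 7 steps if it increments the exponent, else 5. *)
have le_t u : u <= 7 -> t1 + (t2 + u) <= (C1 + C2) * #|V|.+1 ^ 3 + 7.
  by move=> le_u; rewrite mulnDl -addnA leq_add // leq_add.
case A: (reg s2 rAns == 0).
  exists (t1 + (t2 + 7)), (set_reg s2 rK (reg s2 rK).+1); split=> //.
  - apply: ExecSeq ex1 _; apply: ExecSeq ex2 _.
    by apply: (@ExecIfTrue _ _ _ _ 3) => //; apply: (ExecAssign rK (Succ (Reg rK))).
  - exact: le_t.
  - right; split; [|exact/eqP|by rewrite -s2K].
    by move/ans; rewrite (eqP A).
exists (t1 + (t2 + 5)), s2; split=> //.
- apply: ExecSeq ex1 _; apply: ExecSeq ex2 _.
  by apply: (@ExecIfFalse _ _ _ _ 1); [rewrite /= A | apply: ExecSkip].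
- exact: le_t.
- have nzA : reg s2 rAns <> 0 by move/eqP; rewrite A.
  by left; split=> //; [apply/ans | rewrite F2'].
Qed.

(** The induction is on the number [d] of exponents left after the current one.
    For [d = 0] the exponent is [n - 1], whose power is chordal, so that the
    loop cannot be left without an answer. *)
Lemma poc_loop : exists C, forall (V : finType) (G : sgraph V) d s,
    is_input G s -> reg s rAns = 0 -> 0 < reg s rK -> reg s rK + d.+1 = #|V| ->
    (forall j, 0 < j -> j < reg s rK -> ~ chordal (power G j)) ->
  exists t s', [/\ exec (While poc_test poc_body) s t s',
    is_power_of_chordality G (reg s' rK), reg s' rAns <> 0,
    encodes (arr s' aP) (power G (reg s' rK))
    & t <= d.+1 * (C * #|V|.+1 ^ 3 + 15) + 8].
Proof.
have [C round] := poc_round; exists C => V G d s.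
elim: d s => [|d IHd] s sG sA sK Kd low;
  have [t [s1 [ex1 s1G le_t res]]] := round _ _ _ sG;
  have [s1N _] := s1G; have [sN _] := sG.
all: have testT : beval s poc_test by rewrite /= sA sN -Kd /=; lia.
(* The evaluation of [poc_test] costs 7 steps, and leaving the loop one more. *)
all: have stop : reg s1 rAns <> 0 -> exec (While poc_test poc_body) s1 8 s1
  by move=> /eqP nzA; apply: (@ExecWhileFalse poc_test); rewrite /= (negPf nzA).
all: case: res => [[ch nzA s1K s1P] | [nch s1A s1K]].
1,3: exists (7 + t + 8).+1, s1; split;
  [ exact: ExecWhileTrue testT ex1 (stop nzA)
  | by rewrite s1K; split=> // j j0 chj; rewrite leqNgt; apply/negP => /(low j j0)
  | exact: nzA
  | by rewrite s1K
  | nia ].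
- by case: nch; apply: chordal_last_power; rewrite -Kd addn1.
- have [|||u [s2 [ex2 poc2 A2 P2 le_u]]] := IHd s1 s1G s1A.
  + by rewrite s1K.
  + by rewrite s1K addSnnS.
  + move=> j j0; rewrite s1K ltnS leq_eqVlt => /predU1P[->//|]; exact: low.
  exists (7 + t + u).+1, s2; split=> //; last by nia.
  exact: ExecWhileTrue testT ex1 ex2.
Qed.

Theorem theorem5p85 :
  exists compute_power test_chordality : cmd,
    [/\ computes_power compute_power,
        tests_chordality test_chordality
      & exists C : nat,
        forall (V : finType) (G : sgraph V) (s : state),
          is_input G s ->
          exists (t : nat) (s' : state),
            [/\ exec (POC compute_power test_chordality) s t s',
                is_power_of_chordality G (reg s' rK),
                1 < #|V| -> reg s' rAns <> 0 /\
                            encodes (arr s' aP) (power G (reg s' rK))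
              & 0 < #|V| -> t <= C * #|V| ^ 4]].
Proof.
exists (compile power_prog), (compile test_prog); split.
- exact: compile_power_prog.
- exact: compile_test_prog.
have [C loop] := poc_loop; exists (8 * (C + 30)) => V G s sG.
set s0 := set_reg (set_reg s rK 1) rAns 0.
have ex0 t s' : exec (While poc_test poc_body) s0 t s' ->
    exec (POC (compile power_prog) (compile test_prog)) s (2 + (2 + t)) s'.
  move=> ex_t; apply: (ExecSeq (ExecAssign rK (Cst 1) s)).
  exact: (ExecSeq (ExecAssign rAns (Cst 0) _)).
have s0G : is_input G s0 by case: sG.
case: (leqP #|V| 1) => [n_le1|n_gt1].
  exists (2 + (2 + 8)), s0; split=> //.
  - apply: ex0; apply: (@ExecWhileFalse poc_test).
    by case: sG => sN _; rewrite /= sN -leqNgt.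
  - split=> //; apply: chordal_last_power.
    by apply: leq_trans (leq_pred _) n_le1.
  - move=> n_gt0; have ->: #|V| = 1 by apply/eqP; rewrite eqn_leq n_le1.
    by rewrite exp1n; lia.
have [||t [s' [ex_t poc_s' A P le_t]]] := loop V G (#|V| - 2) s0 s0G erefl isT.
- by rewrite /= add1n -subSn // subSS subn1 prednK // ltnW.
- by case.
exists (2 + (2 + t)), s'; split=> //; first exact: ex0.
move=> _; have le8 : #|V|.+1 ^ 3 <= 8 * #|V| ^ 3.
  by rewrite -[8]/(2 ^ 3) -expnMn leq_exp2r // mul2n -addnn -addn1 leq_add2l ltnW.
have cube_gt0 : 0 < #|V| ^ 3 by rewrite expn_gt0 ltnW.
have le_n : (#|V| - 2).+1 <= #|V| by rewrite -subSn // subSS leq_subr.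
rewrite [_ ^ 4]expnSr; move: le_t le8 cube_gt0 le_n n_gt1.
move: (#|V|.+1 ^ 3) (#|V| ^ 3) (#|V| - 2).+1 => E F x; move: #|V| => n.
move=> le_t le8 F_gt0 le_x n_gt1.
have le1 : t <= n * (C * (8 * F) + 15) + 8.
  by apply: leq_trans le_t _; rewrite leq_add2r leq_mul // leq_add2r leq_mul.
have : n <= F * n by rewrite leq_pmull.
have -> : 8 * (C + 30) * (F * n) = n * (C * (8 * F)) + 240 * (F * n) by lia.
rewrite mulnDr in le1; lia.
Qed.
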